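(* Let $\mathcal{E}\in\mathcal{T}_{\mathbb{K}}$ with natural basis $\{e_1,\dots,e_n\}$. Then the following assertions are equivalent: (i) the annihilator of $\mathcal{E}$ is of codimension two; (ii) $\mathcal{E}$ is isomorphic to $\mathcal{E}_2(1,-1,0,\dots,0)$; (iii) $\mathcal{E}$ splits over its abelian socle, i.e. there is a subalgebra $U$ of $\mathcal{E}$ with $\mathcal{E}=\operatorname{Asoc}(\mathcal{E})\oplus U$ as vector spaces; (iv) $F(\mathcal{E})=\phi(\mathcal{E})=0$; (v) $\operatorname{Nil}(\mathcal{E})$ is abelian. Otherwise (i.e. if these equivalent conditions fail), $F(\mathcal{E})=\phi(\mathcal{E})=\operatorname{Nil}(\mathcal{E})^2=\mathcal{E}^2$.
   Context: $\mathbb{K}$ is a field of characteristic different from $2$. An evolution algebra over $\mathbb{K}$ is a finite-dimensional $\mathbb{K}$-algebra (commutative, not necessarily associative) having a basis $\{e_1,\dots,e_n\}$, called a natural basis, with $e_ie_j=0$ for $i\neq j$. For an algebra $\mathcal{A}$ put $\mathcal{A}^1=\mathcal{A}$, $\mathcal{A}^{m+1}=\sum_{i=1}^m\mathcal{A}^i\mathcal{A}^{m+1-i}$, and $\mathcal{A}^{(1)}=\mathcal{A}$, $\mathcal{A}^{(m+1)}=\mathcal{A}^{(m)}\mathcal{A}^{(m)}$ (products of subspaces are linear spans of products); $\mathcal{A}$ is nilpotent (solvable) if $\mathcal{A}^m=0$ (resp. $\mathcal{A}^{(m)}=0$) for some $m$; $\mathcal{A}^2$ is the derived subalgebra; an ideal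 $I$ is abelian if $I^2=0$. $\operatorname{ann}(\mathcal{E})=\{u: u\mathcal{E}=0\}$. $\mathcal{T}_{\mathbb{K}}$ is the class of solvable, non-nilpotent evolution algebras over $\mathbb{K}$ with one-dimensional derived subalgebra; every $\mathcal{E}\in\mathcal{T}_{\mathbb{K}}$ has a unique maximal nilpotent ideal, denoted $\operatorname{Nil}(\mathcal{E})$. $\mathcal{E}_2(1,-1,0,\dots,0)$ is the $n$-dimensional evolution algebra with natural basis $\{e_1,\dots,e_n\}$ and product $e_1^2=-e_2^2=e_1+e_2$, $e_i^2=0$ for $i\ge3$. The abelian socle $\operatorname{Asoc}(\mathcal{E})$ is the sum of all minimal abelian ideals of $\mathcal{E}$. The Frattini subalgebra $F(\mathcal{E})$ is the intersection of all maximal subalgebras of $\mathcal{E}$, and the Frattini ideal $\phi(\mathcal{E})$ is the largest ideal of $\mathcal{E}$ contained in $F(\mathcal{E})$. *)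

(* Defs.v *)
From HB Require Import structures.
From mathcomp Require Import all_boot all_order all_algebra.
From mathcomp Require Import boolp classical_sets.

Set Implicit Arguments.
Unset Strict Implicit.
Unset Printing Implicit Defensive.
Import GRing.Theory.
Local Open Scope ring_scope.

(* Finite-dimensional commutative algebras, not necessarily associative or
   unital. *)
HB.mixin Record Vector_hasNAMul (K : fieldType) A of Vector K A := {
  namul : A -> A -> A;
  namulC : commutative namul;
  namulP : forall x, linear (namul x)
}.

#[short(type="naAlgType")]
HB.structure Definition NAAlgebra (K : fieldType) :=
  {A of Vector_hasNAMul K A & Vector K A}.

HB.instance Definition _ (K : fieldType) (A : naAlgType K) (x : A) :=
  GRing.isLinear.Build K A A *:%R (namul x) (namulP x).

Section ClassicalSubspaces.
Variables (K : fieldType) (V : vectType K).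
Implicit Types (U W : {vspace V}) (S : set V) (P : set {vspace V}).

Lemma ex_max_dim P W0 : P W0 ->
  exists2 W, P W & forall U, P U -> (\dim U <= \dim W)%N.
Proof.
move=> PW0; pose p n := `[< exists2 W, P W & \dim W = n >].
have exp : exists n, p n by exists (\dim W0); apply/asboolP; exists W0.
have ubp n : p n -> (n <= \dim {:V})%N.
  by move=> /asboolP[W _ <-]; rewrite dimvS ?subvf.
case: (ex_maxnP exp ubp) => n /asboolP[W PW <-] maxn.
by exists W => // U PU; apply: maxn; apply/asboolP; exists U.
Qed.

(* The subspace whose set of vectors is S (and 0 if S is not a subspace). *)
Definition vspace_of S : {vspace V} :=
  xget 0%VS [set W | forall x, x \in W <-> S x].

Lemma vspace_ofP S : S 0 -> (forall a u v, S u -> S v -> S (a *: u + v)) ->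
  forall x, x \in vspace_of S <-> S x.
Proof.
move=> S0 SP; apply: (@xgetPex _ 0%VS [set W | forall x, x \in W <-> S x]).
have [|W SW maxW] := @ex_max_dim [set W | forall x, x \in W -> S x] 0%VS.
  by move=> x; rewrite memv0 => /eqP->.
exists W => x; split=> [/SW//|Sx].
suff /eqP-> : (W == W + <[x]>)%VS.
  exact: subvP (addvSr W <[x]>) _ (memv_line x).
rewrite eqEdim addvSl /=; apply: maxW => _ /memv_addP[u /SW Su [_ /vlineP[a ->] ->]].
by rewrite addrC; apply: SP.
Qed.

Definition bigcapv P : {vspace V} :=
  vspace_of [set x | forall U, P U -> x \in U].

Lemma bigcapvP P x : x \in bigcapv P <-> (forall U, P U -> x \in U).
Proof.
apply: vspace_ofP => [U _|a u v Pu Pv U PU]; first exact: mem0v.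
by rewrite memvD ?memvZ ?Pu ?Pv.
Qed.

(* The sum of a possibly infinite family of subspaces. *)
Definition bigsumv P : {vspace V} :=
  vspace_of [set x | exists2 s : seq {vspace V},
    (forall U, U \in s -> P U) & x \in (\sum_(U <- s) U)%VS].

Lemma mem_bigsumv P x : x \in bigsumv P <->
  exists2 s : seq {vspace V},
    (forall U, U \in s -> P U) & x \in (\sum_(U <- s) U)%VS.
Proof.
apply: vspace_ofP => [|a u v [s Ps us] [t Pt vt]].
  by exists [::] => //; rewrite mem0v.
exists (s ++ t) => [U|]; first by rewrite mem_cat => /orP[/Ps|/Pt].
by rewrite big_cat /= memv_add ?memvZ.
Qed.

Lemma bigsumv_sup P U : P U -> (U <= bigsumv P)%VS.
Proof.
move=> PU; apply/subvP => x Ux; apply/mem_bigsumv; exists [:: U].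
  by move=> W; rewrite inE => /eqP->.
by rewrite big_seq1.
Qed.

Lemma bigsumv_sub P W : (forall U, P U -> (U <= W)%VS) -> (bigsumv P <= W)%VS.
Proof.
move=> PW; apply/subvP => x /mem_bigsumv[s Ps]; apply/subvP.
by rewrite big_seq; elim/big_rec: _ => [|U T /Ps/PW UW TW];
  rewrite ?sub0v // subv_add UW.
Qed.

End ClassicalSubspaces.

Section Algebras.
Variables (K : fieldType) (A : naAlgType K).
Implicit Types (U V W I J : {vspace A}) (x y u v : A).

Lemma namul_sum x (J : Type) (r : seq J) (F : J -> A) :
  namul x (\sum_(j <- r) F j) = \sum_(j <- r) namul x (F j).
Proof. exact: raddf_sum. Qed.

Definition naprod U V : {vspace A} :=
  <<[seq namul x y | x <- vbasis U, y <- vbasis V]>>%VS.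

Lemma naprodP U V W :
  reflect (forall x y, x \in U -> y \in V -> namul x y \in W)
          (naprod U V <= W)%VS.
Proof.
apply: (iffP span_subvP) => [UVW x y Ux Vy|UVW _ /allpairsP[[x y] /= [Ux Vy ->]]].
  rewrite (coord_vbasis Vy) namul_sum memv_suml // => j _; rewrite linearZ memvZ //=.
  rewrite (coord_vbasis Ux) namulC namul_sum memv_suml // => i _.
  rewrite linearZ memvZ //= namulC UVW //; apply/allpairsP.
  by exists ((vbasis U)`_i, (vbasis V)`_j); rewrite !mem_nth ?size_tuple.
by rewrite UVW ?vbasis_mem.
Qed.

(* [:: U^1; ...; U^(m+1)], where U^(m+2) = \sum_(i <= m) U^(i+1) U^(m+1-i). *)
Fixpoint napowers U m : seq {vspace A} :=
  if m is m'.+1 then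
    let s := napowers U m' in
    rcons s (\sum_(i < m) naprod (nth 0%VS s i) (nth 0%VS s (m' - i)))%VS
  else [:: U].

(* U^m for m >= 1; the value at m = 0 is irrelevant. *)
Definition napow U m : {vspace A} := last U (napowers U m.-1).

Lemma size_napowers U m : size (napowers U m) = m.+1.
Proof. by elim: m => //= m IHm; rewrite size_rcons IHm. Qed.

Lemma nth_napowers U m i :
  (i <= m)%N -> nth 0%VS (napowers U m) i = napow U i.+1.
Proof.
elim: m => [|m IHm]; first by rewrite leqn0 => /eqP->.
rewrite leq_eqVlt => /orP[/eqP->|lt_i_m].
  by rewrite /napow -nth_last size_napowers; apply: set_nth_default;
     rewrite size_napowers.
by rewrite /= nth_rcons size_napowers lt_i_m IHm.
Qed.

Lemma napow1 U : napow U 1 = U. Proof. by []. Qed.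

Lemma napowS U m : (0 < m)%N ->
  napow U m.+1 = (\sum_(1 <= i < m.+1) naprod (napow U i) (napow U (m.+1 - i)))%VS.
Proof.
case: m => // m _; rewrite {1}/napow /= last_rcons big_add1 big_mkord.
apply: eq_bigr => i _; have le_i_m : (i <= m)%N by rewrite -ltnS.
by rewrite !nth_napowers ?leq_subr // subSS subSn.
Qed.

Lemma napow2 U : napow U 2 = naprod U U.
Proof. by rewrite napowS // big_nat1. Qed.

(* U^(m) for m >= 1. *)
Definition derpow U m : {vspace A} := iter m.-1 (fun V => naprod V V) U.

Definition nilpotent_subspace U := exists2 m, (0 < m)%N & napow U m = 0%VS.
Definition solvable_subspace U := exists2 m, (0 < m)%N & derpow U m = 0%VS.

Definition subalgebra U := (naprod U U <= U)%VS.
Definition ideal I := (naprod I {:A} <= I)%VS.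
Definition abelian_ideal I := ideal I /\ naprod I I = 0%VS.
Definition nilpotent_ideal I := ideal I /\ nilpotent_subspace I.

Definition maximal_subalgebra U :=
  [/\ subalgebra U, U != fullv &
      forall V, subalgebra V -> (U <= V)%VS -> V = U \/ V = fullv].

Definition minimal_abelian_ideal I :=
  [/\ abelian_ideal I, I != 0%VS &
      forall J, abelian_ideal J -> J != 0%VS -> (J <= I)%VS -> J = I].

Definition maximal_nilpotent_ideal I :=
  nilpotent_ideal I /\ forall J, nilpotent_ideal J -> (I <= J)%VS -> J = I.

Definition ann : {vspace A} := vspace_of [set u | forall v, namul u v = 0].

Definition asoc : {vspace A} := bigsumv minimal_abelian_ideal.

Definition frattini : {vspace A} := bigcapv maximal_subalgebra.

Definition largest_ideal_in W I :=
  [/\ ideal I, (I <= W)%VS & forall J, ideal J -> (J <= W)%VS -> (J <= I)%VS].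

Definition frattini_ideal : {vspace A} :=
  xget 0%VS [set I | largest_ideal_in frattini I].

(* A maximal nilpotent ideal always exists (nilradP); it is unique in the class
   in_T below. *)
Definition nilrad : {vspace A} := xget 0%VS [set I | maximal_nilpotent_ideal I].

Lemma annP u : u \in ann <-> (forall v, namul u v = 0).
Proof.
apply: vspace_ofP => [v|a u1 u2 u10 u20 v]; rewrite namulC; first exact: linear0.
by rewrite linearP /= !(namulC v) u10 u20 scaler0 addr0.
Qed.

Lemma ideal_bigsumv (P : set {vspace A}) :
  (forall J, P J -> ideal J) -> ideal (bigsumv P).
Proof.
move=> idP; apply/naprodP => x y /mem_bigsumv[s Ps xs] _.
apply/mem_bigsumv; exists s => //.
elim: s x Ps xs => [|J s IHs] x Ps.
  by rewrite !big_nil !memv0 => /eqP->; rewrite namulC linear0.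
rewrite !big_cons => /memv_addP[u Ju [v sv ->]]; rewrite namulC linearD /=.
rewrite !(namulC y); apply: memv_add.
  have /idP/naprodP := Ps J (mem_head _ _); apply=> //; exact: memvf.
by apply: IHs => // U sU; apply: Ps; rewrite inE sU orbT.
Qed.

Lemma frattini_idealP : largest_ideal_in frattini frattini_ideal.
Proof.
apply: (@xgetPex _ 0%VS [set I | largest_ideal_in frattini I]).
exists (bigsumv [set J | ideal J /\ (J <= frattini)%VS]); split.
- by apply: ideal_bigsumv => J [].
- by apply: bigsumv_sub => J [].
- by move=> J idJ JF; apply: bigsumv_sup.
Qed.

Lemma nilradP : maximal_nilpotent_ideal nilrad.
Proof.
apply: (@xgetPex _ 0%VS [set I | maximal_nilpotent_ideal I]).
have nil0 : nilpotent_ideal 0%VS.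
  split; last by exists 1%N.
  by apply/naprodP => x y; rewrite memv0 => /eqP-> _; rewrite namulC linear0 mem0v.
have [N nilN maxN] := ex_max_dim nil0; exists N; split=> // J nilJ NJ.
by apply/eqP; rewrite eq_sym eqEdim NJ maxN.
Qed.

Definition natural_basis n (e : n.-tuple A) :=
  basis_of fullv e /\ forall i j : 'I_n, i != j -> namul e`_i e`_j = 0.

Definition evolution_algebra := exists n (e : n.-tuple A), natural_basis e.

(* Solvable, non-nilpotent evolution algebras with one-dimensional derived
   subalgebra. *)
Definition in_T :=
  [/\ evolution_algebra, solvable_subspace fullv, ~ nilpotent_subspace fullv &
      \dim (naprod {:A} {:A}) = 1%N].

End Algebras.

Arguments ann {K} A.
Arguments asoc {K} A.
Arguments frattini {K} A.
Arguments frattini_ideal {K} A.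
Arguments nilrad {K} A.
Arguments in_T {K} A.

Definition isomorphic (K : fieldType) (A B : naAlgType K) :=
  exists2 f : {linear A -> B}, bijective f &
    forall x y, f (namul x y) = namul (f x) (f y).

(* The evolution algebra on K^n with e_i^2 = \sum_j M i j *: e_j. *)
Definition evo (K : fieldType) n (M : 'M[K]_n) : Type := 'rV[K]_n.

Section Evo.
Variables (K : fieldType) (n : nat) (M : 'M[K]_n).

HB.instance Definition _ := Vector.on (evo M).

Definition evo_mul (u v : evo M) : evo M :=
  (\row_i ((u : 'rV_n) 0 i * (v : 'rV_n) 0 i)) *m M.

Fact evo_mulC : commutative evo_mul.
Proof.
move=> u v; rewrite /evo_mul; congr (_ *m _).
by apply/rowP => i; rewrite !mxE mulrC.
Qed.

Fact evo_mulP u : linear (evo_mul u).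
Proof.
suff H a (v w : 'rV_n) : evo_mul u (a *: v + w : 'rV_n) =
    a *: (evo_mul u v : 'rV_n) + (evo_mul u w : 'rV_n) by exact: H.
rewrite /evo_mul scalemxAl -mulmxDl; congr (_ *m _).
by apply/rowP => i; rewrite !mxE mulrDr mulrCA.
Qed.

HB.instance Definition _ := Vector_hasNAMul.Build K (evo M) evo_mulC evo_mulP.

End Evo.

(* e_0^2 = - e_1^2 = e_0 + e_1 and e_i^2 = 0 for i >= 2; meant for n >= 2. *)
Definition E2 (K : fieldType) n : naAlgType K :=
  evo (\matrix_(i < n, j < n)
    (((i == 0%N :> nat)%:R - (i == 1%N :> nat)%:R) * (j < 2)%N%:R : K)).

Lemma E2_mul (K : fieldType) n (i j : 'I_n.+2) :
  let e (k : 'I_n.+2) : E2 K n.+2 := (delta_mx 0 k : 'rV[K]_n.+2) in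
  namul (e i) (e j) =
    if i == j then
      ((i == 0%N :> nat)%:R - (i == 1%N :> nat)%:R) *: (e 0 + e 1)
    else 0.
Proof.
move=> e; suff : (namul (e i) (e j) : 'rV_n.+2) = if i == j then
    ((i == 0%N :> nat)%:R - (i == 1%N :> nat)%:R) *: (delta_mx 0 0 + delta_mx 0 1)
  else 0 :> 'rV[K]_n.+2 by [].
have -> : (namul (e i) (e j) : 'rV_n.+2) = (\row_k ((e i : 'rV_n.+2) 0 k *
  (e j : 'rV_n.+2) 0 k)) *m (\matrix_(i, j) (((i == 0%N :> nat)%:R -
  (i == 1%N :> nat)%:R) * (j < 2)%N%:R)) by [].
apply/rowP => k; rewrite mxE (bigD1 i) //= big1 => [|l /negPf li]; last first.
  by rewrite /e !mxE li !(andbF, mul0r).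
rewrite /e !mxE !eqxx /= addr0 mul1r; case: (i == j); last by rewrite !mxE mul0r.
rewrite mul1r !mxE !eqxx /=; congr (_ * _).
by case: k => -[|[|k]] ?; rewrite /= -?natrD.
Qed.

(* Main.v *)
(** Write the derived algebra as the line of [a], so that [x y = B(x, y) a] for a symmetric
    bilinear form [B] whose radical is the annihilator.  Solvability says that [a] is isotropic,
    and non-nilpotency that [a] is not in the radical; as 2 is invertible, [a] is part of a
    hyperbolic pair [(a, b)].  Then Nil(E) is the hyperplane orthogonal to [a], Asoc(E) is
    ann(E) + <a>, and a subspace is a subalgebra iff it contains [a] or is totally
    isotropic.  Each of the five conditions amounts to E = ann(E) + <a> + <b>, and when it
    fails every maximal subalgebra contains [a].  The natural basis only serves to identify
    [n] with dim E. *)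

From HB Require Import structures.
Require Import Defs.
From mathcomp Require Import all_boot all_order all_algebra.
From mathcomp Require Import boolp.
From mathcomp Require Import zify.
Import GRing.Theory.
Set Implicit Arguments.
Unset Strict Implicit.
Unset Printing Implicit Defensive.
Local Open Scope ring_scope.

(** * Hyperplanes and linear functionals *)

Section Subspaces.
Context {K : fieldType} {V : vectType K}.
Implicit Types (U W : {vspace V}) (u v : V).

Lemma dim_lker_functional (g : 'Hom(V, K^o)) : (\dim {:V} <= \dim (lker g) + 1)%N.
Proof.
rewrite -(limg_ker_dim g fullv) capfv leq_add2l.
by apply: leq_trans (dimvS (subvf _)) _; rewrite dimvf.
Qed.

Lemma dim_cap_hyperplanes U W : (\dim {:V} <= \dim U + 1)%N ->
  (\dim {:V} <= \dim W + 1)%N -> (\dim {:V} <= \dim (U :&: W) + 2)%N.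
Proof.
move=> hU hW; have := dimv_sum_cap U W; have := dimvS (subvf (U + W)).
by rewrite /=; lia.
Qed.

(** Adding to the line of [u] a complement of the plane spanned by [u] and [v] loses only the
    direction of [v]. *)
Lemma exists_hyperplane u v : v \notin <[u]>%VS ->
  exists H : {vspace V}, [/\ u \in H, v \notin H & (\dim {:V} <= \dim H + 1)%N].
Proof.
move=> uv; pose W := (<[u]> + <[v]>)%VS; exists (<[u]> + W^C)%VS.
split.
- by rewrite (subvP (addvSl _ _)) ?memv_line.
- apply: contra uv => /memv_addP[x xu [c cW vE]].
  suff : c \in (W :&: W^C)%VS.
    by rewrite capv_compl memv0 => /eqP c0; rewrite vE c0 addr0.
  rewrite memv_cap cW andbT; have -> : c = v - x by rewrite vE addrAC subrr add0r.
  by rewrite memvB // ?(subvP (addvSr _ _) _ (memv_line v)) // (subvP (addvSl _ _)).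
- have : (<[v]> + (<[u]> + W^C) = fullv)%VS.
    by rewrite addvA (addvC <[v]>%VS) addv_complf.
  move=> <-; apply: leq_trans (dimv_add_leqif _ _) _.
  by rewrite addnC leq_add2l dim_vline leq_b1.
Qed.

End Subspaces.

(** * Products of subspaces, nilpotency and subalgebras *)

Section Algebra.
Context {K : fieldType} {A : naAlgType K}.
Implicit Types (U V J : {vspace A}) (u v x y : A).

Lemma namulZr c x y : namul x (c *: y) = c *: namul x y.
Proof. exact: linearZ. Qed.

Lemma namulZl c x y : namul (c *: x) y = c *: namul x y.
Proof. by rewrite namulC namulZr namulC. Qed.

Lemma namulDr x y z : namul x (y + z) = namul x y + namul x z.
Proof. exact: linearD. Qed.

Lemma namulDl x y z : namul (x + y) z = namul x z + namul y z.
Proof. by rewrite namulC namulDr !(namulC z). Qed.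

Lemma namul0r x : namul x 0 = 0. Proof. exact: linear0. Qed.

Lemma naprod_mem U V x y : x \in U -> y \in V -> namul x y \in naprod U V.
Proof. exact/naprodP. Qed.

Lemma naprod_eq0 U V :
  (forall x y, x \in U -> y \in V -> namul x y = 0) -> naprod U V = 0%VS.
Proof.
move=> UV0; apply/eqP; rewrite -subv0; apply/naprodP => x y Ux Vy.
by rewrite UV0 // mem0v.
Qed.

Lemma naprod0P U V x y : naprod U V = 0%VS -> x \in U -> y \in V -> namul x y = 0.
Proof. by move=> UV0 Ux Vy; apply/eqP; rewrite -memv0 -UV0 naprod_mem. Qed.

Lemma napow_mem U m x y : (0 < m)%N -> x \in U -> y \in napow U m ->
  namul x y \in napow U m.+1.
Proof.
move=> m0 Ux Uy; rewrite napowS // big_ltn // subSS subn0.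
by rewrite (subvP (addvSl _ _)) // naprod_mem.
Qed.

(** By commutativity the two summands U U^2 and U^2 U of the third power vanish together, so one
    bracketing suffices. *)
Lemma nilpotent_of_cube0 U :
  (forall x y z, x \in U -> y \in U -> z \in U -> namul x (namul y z) = 0) ->
  nilpotent_subspace U.
Proof.
move=> U0; exists 3 => //.
have E : naprod U (naprod U U) = 0%VS.
  apply: naprod_eq0 => x y Ux Uy.
  (* Being killed by [x] is a linear condition, so it passes from products to their span. *)
  have /subvP/(_ y Uy) : (naprod U U <= lker (linfun (namul x)))%VS.
    by apply/naprodP => z t Uz Ut; rewrite memv_ker lfunE /= U0.
  by rewrite memv_ker lfunE => /eqP.
rewrite napowS // big_ltn // big_nat1 !subSS !subn0 napow1 napow2 E add0v.
apply: naprod_eq0 => x y Ux Uy; rewrite namulC; exact: naprod0P E Uy Ux.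
Qed.

Lemma line_minimal_abelian_ideal u : u != 0 ->
  (forall x, namul u x \in <[u]>%VS) -> namul u u = 0 ->
  minimal_abelian_ideal <[u]>%VS.
Proof.
move=> u0 uu u20; split=> [||J _ J0 Ju].
- split; first by apply/naprodP => _ y /vlineP[c ->] _; rewrite namulZl memvZ.
  apply: naprod_eq0 => _ _ /vlineP[c ->] /vlineP[d ->].
  by rewrite namulZl namulZr u20 !scaler0.
- by rewrite -dimv_eq0 dim_vline u0.
- by apply/eqP; rewrite eqEdim Ju dim_vline u0 lt0n dimv_eq0.
Qed.

Lemma hyperplane_maximal_subalgebra U : subalgebra U -> U != fullv ->
  (\dim {:A} <= \dim U + 1)%N -> maximal_subalgebra U.
Proof.
move=> algU Ufull dimU; split=> // V _ UV.
have [VU|VU] := leqP (\dim V) (\dim U).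
  by left; apply/eqP; rewrite eq_sym eqEdim UV.
by right; apply/eqP; rewrite eqEdim subvf; lia.
Qed.

Lemma annE u : (u \in ann A) = `[< forall v, namul u v = 0 >].
Proof. by apply/idP/asboolP => /annP. Qed.

Lemma ann_mulr u v : u \in ann A -> namul u v = 0.
Proof. by move/annP. Qed.

Lemma ann_mull u v : u \in ann A -> namul v u = 0.
Proof. by move=> /annP uE; rewrite namulC. Qed.

Lemma subalgebra_of_mul0 U : (forall x y, x \in U -> y \in U -> namul x y = 0) ->
  subalgebra U.
Proof. by move=> U0; rewrite /subalgebra naprod_eq0 // sub0v. Qed.

End Algebra.

(** With products written as B(x, y) [a], the last three equations say B(a, a) = 0, B(a, b) = 1 and
    B(b, b) = 0. *)
Definition hyperbolic_pair (K : fieldType) (E : naAlgType K) (a b : E) :=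
  [/\ a != 0, naprod {:E} {:E} = <[a]>%VS, namul a a = 0, namul a b = a & namul b b = 0].

(** * The bilinear form attached to a hyperbolic pair *)

Section HyperbolicPair.
Context {K : fieldType} {E : naAlgType K}.
Variables a b : E.
Hypothesis abP : hyperbolic_pair a b.

Let a_neq0 : a != 0. Proof. by case: abP. Qed.
Let derE : naprod {:E} {:E} = <[a]>%VS. Proof. by case: abP. Qed.
Let aa : namul a a = 0. Proof. by case: abP. Qed.
Let ab : namul a b = a. Proof. by case: abP. Qed.
Let bb : namul b b = 0. Proof. by case: abP. Qed.
Let ba : namul b a = a. Proof. by rewrite namulC. Qed.

Implicit Types (U J M : {vspace E}) (x y : E).

(** The functional B(x, -); as a bundled linear map, its [lker] is the orthogonal of [x] as a
    subspace. *)
Definition form_fun x : 'Hom(E, K^o) :=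
  linfun (coord [tuple a] ord0 \o namul x : E -> K^o).

Definition form x y : K := form_fun x y.

Lemma namul_form x y : namul x y = form x y *: a.
Proof.
have /vlineP[c cE] : namul x y \in <[a]>%VS by rewrite -derE naprod_mem ?memvf.
suff -> : form x y = c by [].
rewrite /form lfunE /= cE linearZ /= (@coord_free _ _ 1 [tuple a] ord0 ord0) ?mulr1 //=.
by rewrite free_cons nil_free span_nil memv0 a_neq0.
Qed.

Lemma form_eq0 x y : (form x y == 0) = (namul x y == 0).
Proof. by rewrite namul_form scaler_eq0 (negPf a_neq0) orbF. Qed.

Lemma mem_orth x y : (y \in lker (form_fun x)) = (namul x y == 0).
Proof. by rewrite memv_ker -form_eq0. Qed.

Lemma subalgebra_of_mem M : a \in M -> subalgebra M.
Proof. by move=> Ma; apply/naprodP => x y _ _; rewrite namul_form memvZ. Qed.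

(** The product is a multiple of [a] lying in [M], and a nonzero multiple would bring [a] into
    [M]. *)
Lemma subalgebra_notin M x y : subalgebra M -> a \notin M ->
  x \in M -> y \in M -> namul x y = 0.
Proof.
move=> /naprodP algM Ma Mx My; apply/eqP; rewrite -form_eq0; apply: contraNT Ma => xy0.
by have := algM _ _ Mx My; rewrite namul_form rpredZeq (negPf xy0).
Qed.

Lemma mem_ideal J x y : ideal J -> x \in J -> namul x y != 0 -> a \in J.
Proof.
move=> /naprodP idJ Jx xy0; have := idJ x y Jx (memvf y).
by rewrite namul_form rpredZeq form_eq0 (negPf xy0).
Qed.

(** * The annihilator and its codimension *)

Let a_annN : a \notin ann E.
Proof. by apply/negP => /annP/(_ b)/eqP; rewrite ab (negPf a_neq0). Qed.

Lemma orth_a_ann : (ann E + <[a]> <= lker (form_fun a))%VS.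
Proof.
rewrite subv_add -memvE mem_orth aa eqxx andbT.
by apply/subvP => u uE; rewrite mem_orth ann_mull.
Qed.

Lemma namul_ann_plane u c d : u \in ann E ->
  namul (u + c *: a + d *: b) a = d *: a /\
  namul (u + c *: a + d *: b) b = c *: a.
Proof.
move=> uE; rewrite !namulDl !namulZl !(ann_mulr _ uE) aa ab ba bb !scaler0 !add0r.
by rewrite addr0.
Qed.

(** The annihilator misses [a], and [ann E + <[a]>] lies in the orthogonal of [a], which misses
    [b]. *)
Lemma ann_plane_direct :
  ((ann E :&: <[a]> = 0)%VS * ((ann E + <[a]>) :&: <[b]> = 0)%VS)%type.
Proof.
split; apply/eqP; rewrite -subv0; apply/subvP => v /memv_capP[vE /vlineP[d vd]].
  apply: contraNT a_annN; rewrite vd memv0 scaler_eq0 negb_or => /andP[d0 _].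
  by move: vE; rewrite vd rpredZeq (negPf d0).
have : namul a v == 0 by rewrite -mem_orth (subvP orth_a_ann).
by rewrite vd namulZr ab scaler_eq0 (negPf a_neq0) orbF => /eqP->; rewrite scale0r mem0v.
Qed.

Lemma dim_ann_plane : \dim (ann E + <[a]> + <[b]>) = (\dim (ann E) + 2)%N.
Proof.
have b0 : b != 0 by apply: contraNneq a_neq0 => b0; rewrite -ab b0 namul0r.
by rewrite !dimv_disjoint_sum ?ann_plane_direct // !dim_vline a_neq0 b0 -addnA.
Qed.

Lemma codim_annP : (\dim (ann E) + 2 = \dim {:E})%N ->
  forall x, exists u c d, u \in ann E /\ x = u + c *: a + d *: b.
Proof.
move=> dimE x; have : x \in (ann E + <[a]> + <[b]>)%VS.
  suff -> : (ann E + <[a]> + <[b]> = fullv)%VS by rewrite memvf.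
  by apply/eqP; rewrite eqEdim subvf dim_ann_plane dimE /=.
move=> /memv_addP[_ /memv_addP[u uE [_ /vlineP[c ->] ->]] [_ /vlineP[d ->] ->]].
by exists u, c, d.
Qed.

(** Codimension at least two is automatic, as [a] and [b] are independent modulo [ann E];
    intersecting two hyperplanes costs at most two dimensions, which gives the other bound. *)
Lemma codim_ann_eq2 U W : (\dim {:E} <= \dim U + 1)%N ->
  (\dim {:E} <= \dim W + 1)%N -> (U :&: W <= ann E)%VS ->
  (\dim (ann E) + 2 = \dim {:E})%N.
Proof.
move=> hU hW /dimvS hUW; have := dim_cap_hyperplanes hU hW.
by have := dimvS (subvf (ann E + <[a]> + <[b]>)); rewrite dim_ann_plane; lia.
Qed.

Lemma mem_ann_of_spanning M v :
  (M + <[a]> = fullv)%VS -> namul v a = 0 -> (forall x, x \in M -> namul v x = 0) ->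
  v \in ann E.
Proof.
move=> Ma va vM; apply/annP => y; have := memvf y; rewrite -Ma.
by move=> /memv_addP[x Mx [_ /vlineP[c ->] ->]]; rewrite namulDr namulZr va scaler0 addr0 vM.
Qed.

(** A vector of [M] orthogonal to [a] is orthogonal to both summands, hence lies in the annihilator;
    so [M] and the orthogonal of [a] serve as the two hyperplanes. *)
Lemma codim_ann_of_complement M : (M + <[a]> = fullv)%VS ->
  (forall x y, x \in M -> y \in M -> namul x y = 0) -> (\dim (ann E) + 2 = \dim {:E})%N.
Proof.
move=> Ma M0; apply: (@codim_ann_eq2 M (lker (form_fun a))).
- rewrite -Ma; apply: leq_trans (dimv_add_leqif _ _) _.
  by rewrite leq_add2l dim_vline leq_b1.
- exact: dim_lker_functional.
- apply/subvP => v /memv_capP[Mv]; rewrite mem_orth => /eqP av.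
  by apply: (mem_ann_of_spanning Ma) => [|x Mx]; [rewrite namulC | exact: M0].
Qed.

(** * The nilradical and the abelian socle *)

Lemma nilrad_orth : nilrad E = lker (form_fun a).
Proof.
have [[idN nilN] maxN] := nilradP E.
(* Every product is a multiple of [a], and [a] is orthogonal to itself. *)
have idO : ideal (lker (form_fun a)).
  apply/naprodP => x y _ _; rewrite namul_form memvZ // mem_orth aa //.
apply/esym/maxN.
  split=> //; apply: nilpotent_of_cube0 => x y z Ox _ _; rewrite (namul_form y) namulZr.
  by move: Ox; rewrite mem_orth namulC => /eqP->; rewrite scaler0.
(* If [x a] is nonzero, then [a] belongs to the ideal and multiplication by [x] reproduces it up to
   a nonzero scalar, so no power of the ideal vanishes. *)
apply/subvP => x Nx; rewrite mem_orth namulC; apply: contraPT nilN => xa [m m0 Nm0].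
have Na : a \in nilrad E by apply: mem_ideal Nx xa.
suff aP k : a \in napow (nilrad E) k.+1.
  by have := aP m.-1; rewrite prednK // Nm0 memv0 (negPf a_neq0).
elim: k => [|k IHk]; first by rewrite napow1.
by have := napow_mem (ltn0Sn k) Nx IHk; rewrite namul_form rpredZeq form_eq0 (negPf xa).
Qed.

Lemma asocE : asoc E = (ann E + <[a]>)%VS.
Proof.
have minA : minimal_abelian_ideal <[a]>%VS.
  apply: line_minimal_abelian_ideal => // x; by rewrite namul_form memvZ ?memv_line.
apply/eqP; rewrite eqEsubv; apply/andP; split.
  apply: bigsumv_sub => J [[idJ J0] _ minJ].
  (* A minimal abelian ideal not inside the annihilator contains [a], so minimality makes it the
     line of [a]. *)
  have [/subvP/(_ _)Jann|/subvPn[x Jx]] := boolP (J <= ann E)%VS.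
    by apply/subvP => x /Jann; apply/subvP/addvSl.
  rewrite annE => /asboolPn/existsNP[y /eqP xy]; have Ja := mem_ideal idJ Jx xy.
  by case: minA => abA A0 _; rewrite -(minJ _ abA A0) ?addvSr // -memvE.
rewrite subv_add (bigsumv_sup minA) andbT; apply/subvP => u uE.
have [->|u0] := eqVneq u 0; first exact: mem0v.
rewrite memvE; apply: bigsumv_sup; apply: line_minimal_abelian_ideal => // [x|];
  by rewrite ann_mulr ?mem0v.
Qed.

(** In codimension two the line of [b] is a complement. Conversely a complement [U] avoids [a], so
    it is totally isotropic, and so is [ann E + U], which spans together with [a]. *)
Lemma codim_ann_splits : (\dim (ann E) + 2 = \dim {:E})%N <->
  exists U, [/\ subalgebra U, (asoc E + U)%VS = fullv & (asoc E :&: U)%VS = 0%VS].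
Proof.
rewrite asocE; split=> [dimE|[U [algU AU AU0]]].
  exists <[b]>%VS; split.
  - apply: subalgebra_of_mul0 => _ _ /vlineP[c ->] /vlineP[d ->].
    by rewrite namulZl namulZr bb !scaler0.
  - by apply/eqP; rewrite eqEdim subvf dim_ann_plane dimE /=.
  - by rewrite ann_plane_direct.
apply: (@codim_ann_of_complement (ann E + U)); first by rewrite -addvA (addvC U) addvA.
have aU : a \notin U.
  apply: contra a_neq0 => Ua; rewrite -memv0 -AU0 memv_cap Ua andbT.
  by rewrite (subvP (addvSr _ _)) ?memv_line.
move=> _ _ /memv_addP[u uE [x Ux ->]] /memv_addP[v vE [y Uy ->]].
by rewrite namulDl ann_mulr // add0r namulDr ann_mull // (subalgebra_notin algU) // addr0.
Qed.

(** * The Frattini subalgebra and the Frattini ideal *)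

Lemma frattini_sub_a : (frattini E <= <[a]>)%VS.
Proof.
apply/subvP => x /bigcapvP maxx; apply: contraT => xa.
(* Any hyperplane through [a] is a maximal subalgebra; one avoiding [x] excludes it from the
   intersection. *)
have [H [Ha Hx dimH]] := exists_hyperplane xa.
case/negP: (Hx); apply: maxx; apply: hyperplane_maximal_subalgebra => //.
  exact: subalgebra_of_mem.
by apply: contraNneq Hx => ->; rewrite memvf.
Qed.

Lemma frattini_eq0 : (\dim (ann E) + 2 = \dim {:E})%N -> frattini E = 0%VS.
Proof.
(* This hyperplane has zero product and misses [a]: a maximal subalgebra meeting the line of [a] in
   zero. *)
move=> dimE; pose M := (ann E + <[b]>)%VS.
have Mb x : x \in M -> namul x b = 0.
  move=> /memv_addP[u uE [_ /vlineP[d ->] ->]].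
  by rewrite namulDl namulZl bb scaler0 addr0 ann_mulr.
have Ma : a \notin M by apply: contra a_neq0 => /Mb; rewrite ab => ->.
have maxM : maximal_subalgebra M.
  apply: hyperplane_maximal_subalgebra.
  - apply: subalgebra_of_mul0 => x _ Mx /memv_addP[u uE [_ /vlineP[d ->] ->]].
    by rewrite namulDr namulZr Mb // scaler0 addr0 ann_mull.
  - by apply: contraNneq Ma => ->; rewrite memvf.
  - rewrite -dimE -dim_ann_plane -addvA (addvC <[a]>%VS) addvA.
    by apply: leq_trans (dimv_add_leqif _ _) _; rewrite leq_add2l dim_vline leq_b1.
apply/eqP; rewrite -subv0; apply/subvP => x Fx.
have /vlineP[c cE] := subvP frattini_sub_a x Fx.
move/bigcapvP: Fx => /(_ M maxM); rewrite cE rpredZeq (negPf Ma) orbF => /eqP->.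
by rewrite scale0r mem0v.
Qed.

Lemma frattini_eq_a : (\dim (ann E) + 2 <> \dim {:E})%N ->
  frattini E = <[a]>%VS /\ frattini_ideal E = <[a]>%VS.
Proof.
move=> dimE; have FE : frattini E = <[a]>%VS.
  apply/eqP; rewrite eqEsubv frattini_sub_a -memvE; apply/bigcapvP => M [algM _ maxM].
  (* A maximal subalgebra missing [a] is totally isotropic and, by maximality, complements the line
     of [a]; this forces codimension two. *)
  apply: contraPT dimE => aM; have aMa : a \in (M + <[a]>)%VS.
    by rewrite (subvP (addvSr _ _)) ?memv_line.
  have [MaE|Ma] := maxM _ (subalgebra_of_mem aMa) (addvSl _ _).
    by rewrite -MaE aMa in aM.
  by apply; apply: (codim_ann_of_complement Ma) => x y; apply: subalgebra_notin.
split=> //; have [_ + maxF] := frattini_idealP E; rewrite FE in maxF *.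
move=> FI; apply/eqP; rewrite eqEsubv FI; apply: maxF; rewrite ?subvv //.
by apply/naprodP => x y _ _; rewrite namul_form memvZ ?memv_line.
Qed.

(** In codimension two the orthogonal of [a] is [ann E + <[a]>], where products vanish. Conversely,
    the orthogonals of [a] and [b] then meet inside the annihilator. *)
Lemma nilrad_abelianP :
  (\dim (ann E) + 2 = \dim {:E})%N <-> naprod (nilrad E) (nilrad E) = 0%VS.
Proof.
rewrite nilrad_orth; split=> [dimE|N0].
  suff NE x : x \in lker (form_fun a) -> x \in (ann E + <[a]>)%VS.
    apply: naprod_eq0 => x y /NE/memv_addP[u uE [_ /vlineP[c ->] ->]].
    move=> /NE/memv_addP[v vE [_ /vlineP[d ->] ->]].
    by rewrite namulDl ann_mulr // namulDr ann_mull // namulZl namulZr aa !scaler0 !addr0.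
  have [u [c [d [uE ->]]]] := codim_annP dimE x.
  rewrite mem_orth namulC (namul_ann_plane c d uE).1 scaler_eq0 (negPf a_neq0) orbF => /eqP->.
  by rewrite scale0r addr0 memv_add // memvZ ?memv_line.
apply: codim_ann_eq2 (dim_lker_functional (form_fun a)) (dim_lker_functional (form_fun b)) _.
apply/subvP => x /memv_capP[Nx]; rewrite mem_orth namulC => /eqP xb.
(* Subtracting B(a, y) [b] moves [y] into the orthogonal of [a], where [x] kills it; [x] kills [b]
   as well. *)
apply/annP => y; have Ny : y - form a y *: b \in lker (form_fun a).
  by rewrite mem_orth namulDr -scaleNr namulZr ab scaleNr -namul_form subrr.
by rewrite -[y](subrK (form a y *: b)) namulDr namulZr xb scaler0 addr0 (naprod0P N0).
Qed.

Lemma nilrad_square : (\dim (ann E) + 2 <> \dim {:E})%N ->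
  naprod (nilrad E) (nilrad E) = <[a]>%VS.
Proof.
move=> dimE; apply/eqP; rewrite eqEdim dim_vline a_neq0 lt0n dimv_eq0; apply/andP; split.
  by apply/naprodP => x y _ _; rewrite namul_form memvZ ?memv_line.
by apply/eqP => N0; apply/dimE/nilrad_abelianP.
Qed.

End HyperbolicPair.

(** * Existence of hyperbolic pairs and comparison with the model algebra *)

Section Models.
Context {K : fieldType}.
Hypothesis two_neq0 : 2%:R != 0 :> K.

(** The first two rows of the structure matrix are opposite and all others vanish, so only the first
    two coordinates matter. *)
Lemma E2_namulE n (u v : 'rV[K]_n.+2) :
  (namul (u : E2 K n.+2) (v : E2 K n.+2) : 'rV_n.+2) =
  (u 0 0 * v 0 0 - u 0 1 * v 0 1) *: \row_j (j < 2)%N%:R.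
Proof.
apply/rowP => j; have -> : (namul (u : E2 K n.+2) (v : E2 K n.+2) : 'rV_n.+2) =
  (\row_k (u 0 k * v 0 k)) *m \matrix_(i, j)
    (((i == 0%N :> nat)%:R - (i == 1%N :> nat)%:R) * (j < 2)%N%:R) by [].
rewrite mxE !big_ord_recl big1 => [|i _]; last by rewrite !mxE /= subr0 mul0r mulr0.
rewrite !mxE /= addr0 subr0 mul1r sub0r mulN1r mulrN -mulrBl.
by congr ((_ - u 0 _ * v 0 _) * _); apply: val_inj.
Qed.

Lemma in_T_hyperbolic_pair (E : naAlgType K) :
  in_T E -> exists a b : E, hyperbolic_pair a b.
Proof.
case=> _ solE nilE dimE2; pose W := naprod {:E} {:E}; pose a := vpick W.
have a0 : a != 0 by rewrite vpick0 -dimv_eq0 dimE2.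
have WE : W = <[a]>%VS.
  by apply/eqP; rewrite eq_sym eqEdim -memvE memv_pick dimE2 dim_vline a0.
have mulE x y : exists c, namul x y = c *: a.
  by apply/vlineP; rewrite -WE naprod_mem ?memvf.
have aa : namul a a = 0.
  have [c aac] := mulE a a; have [c0|c0] := eqVneq c 0; first by rewrite aac c0 scale0r.
  (* Were [c] nonzero, [a] would survive in every term of the derived series. *)
  case: solE => m _ Em0; suff : a \in derpow {:E} m by rewrite Em0 memv0 (negPf a0).
  rewrite /derpow; elim: m.-1 => [|k IHk] /=; first exact: memvf.
  by have := naprod_mem IHk IHk; rewrite aac rpredZeq (negPf c0).
have [x ax] : exists x, namul a x != 0.
  (* If [a] killed everything, all triple products would vanish and [E] would be nilpotent. *)
  apply: contrapT => /forallNP a_ann; apply/nilE/nilpotent_of_cube0 => x y z _ _ _.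
  have [c ->] := mulE y z; rewrite namulZr namulC.
  by have /negP := a_ann x; rewrite negbK => /eqP->; rewrite scaler0.
have [c axc] := mulE a x.
have c0 : c != 0 by apply: contraNneq ax => c0; rewrite axc c0 scale0r.
have [y ay] : exists y, namul a y = a.
  by exists (c^-1 *: x); rewrite namulZr axc scalerA mulVf // scale1r.
(* The shift removes twice (d/2) [a] from the square of [y], leaving zero, and keeps the product
   with [a] since [a] is isotropic. *)
have [d yyd] := mulE y y; exists a, (y - (d / 2%:R) *: a); split=> //; rewrite -scaleNr.
  by rewrite namulDr namulZr aa scaler0 addr0.
rewrite namulDl !namulDr !namulZl !namulZr aa ay (namulC y a) ay yyd !scaler0 addr0.
have dd : d / 2%:R + d / 2%:R = d by rewrite -mulr2n -[LHS]mulr_natr divfK.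
by rewrite -!scalerDl -addrA -opprD dd subrr scale0r.
Qed.

(** With h = a/2, the vectors [h + b] and [h - b] are orthogonal, have squares [a] and [- a], and
    sum to [a]. Completed by a basis of the annihilator, they have the multiplication table of the
    model. *)
Lemma isomorphic_E2 (E : naAlgType K) (a b : E) : hyperbolic_pair a b ->
  (\dim (ann E) + 2 = \dim {:E})%N -> isomorphic E (E2 K (\dim (ann E)).+2).
Proof.
move=> abP dimE; set m := \dim (ann E); have [a0 derE aa ab bb] := abP.
have ba : namul b a = a by rewrite namulC.
have [h [hh hb h0 ha]] : exists h, [/\ h + h = a, namul h b = h, namul h h = 0 &
    h \in <[a]>%VS].
  exists (2%:R^-1 *: a); rewrite memvZ ?memv_line // !namulZl namulZr aa !scaler0 ab.
  by split=> //; rewrite -mulr2n -scaler_nat scalerA mulfV // scale1r.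
have bh : namul b h = h by rewrite namulC.
pose t := [tuple of h + b :: h - b :: vbasis (ann E)].
have pt : h + b \in <<t>>%VS by rewrite memv_span // mem_head.
have qt : h - b \in <<t>>%VS by rewrite memv_span // !inE eqxx orbT.
have aE : a = (h + b) + (h - b) by rewrite addrACA subrr addr0 hh.
have at_ : a \in <<t>>%VS by rewrite aE memvD.
have bas_t : basis_of fullv t.
  rewrite basisEdim size_tuple -dimE addn2 leqnn andbT; apply/subvP => x _.
  have [u [c [d [uE ->]]]] := codim_annP abP dimE x.
  rewrite !memvD ?memvZ //.
    apply: subvP uE; rewrite -{1}(span_basis (vbasisP (ann E))); apply: sub_span.
    by move=> y yX; rewrite !inE yX !orbT.
  by rewrite -[b](addKr h) memvD // memvN; apply: subvP ha; rewrite -memvE.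
pose f x : E2 K m.+2 := \row_j coord t j x : 'rV[K]_m.+2.
have lin_f : linear f.
  move=> c x y; suff : (\row_j coord t j (c *: x + y)) =
    c *: (\row_j coord t j x) + \row_j coord t j y by [].
  by apply/rowP => j; rewrite !mxE linearP.
pose F : {linear E -> E2 K m.+2} := HB.pack f (GRing.isLinear.Build _ _ _ _ f lin_f).
have free_t := basis_free bas_t.
have spanE x : x = \sum_(j < m.+2) coord t j x *: t`_j.
  by rewrite -coord_span // (span_basis bas_t) memvf.
have decomp x : exists2 u, u \in ann E &
    x = coord t 0 x *: (h + b) + coord t 1 x *: (h - b) + u.
  exists (\sum_(i < m) coord t (lift ord0 (lift ord0 i)) x *: (vbasis (ann E))`_i).
    by apply: memv_suml => i _; rewrite memvZ // vbasis_mem // mem_nth ?size_tuple.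
  have -> : (1 : 'I_m.+2) = lift ord0 ord0 by apply: val_inj.
  by rewrite {1}[x]spanE !big_ord_recl addrA.
have pp : namul (h + b) (h + b) = a.
  by rewrite namulDl !namulDr hb bh h0 bb add0r addr0.
have qq : namul (h - b) (h - b) = - a.
  rewrite namulDl !namulDr -scaleN1r !namulZl !namulZr hb bh h0 bb !scaler0 add0r addr0.
  by rewrite -scalerDr hh scaleN1r.
have pq : namul (h + b) (h - b) = 0.
  rewrite namulDl !namulDr -scaleN1r !namulZr hb bh h0 bb scaler0 add0r addr0.
  by rewrite scaleN1r addNr.
exists F.
  exists (fun r : E2 K m.+2 => \sum_(j < m.+2) (r : 'rV_m.+2) 0 j *: t`_j) => [x|r].
    by rewrite [RHS]spanE; apply: eq_bigr => j _; rewrite mxE.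
  suff : \row_j coord t j (\sum_(i < m.+2) (r : 'rV_m.+2) 0 i *: t`_i) = r by [].
  by apply/rowP => j; rewrite mxE coord_sum_free.
move=> x y; suff -> : namul x y =
    (coord t 0 x * coord t 0 y - coord t 1 x * coord t 1 y) *: a.
  suff : (\row_j coord t j ((coord t 0 x * coord t 0 y - coord t 1 x * coord t 1 y) *: a)) =
    (namul (f x) (f y) : 'rV_m.+2) by [].
  rewrite E2_namulE; apply/rowP => j; rewrite !mxE linearZ /=; congr (_ * _).
  (* Refolding [h + b] and [h - b] as the first two entries of [t] gives [a] the coordinates (1, 1,
     0, ..., 0). *)
  rewrite aE linearD /= -[h + b]/(t`_(@ord0 m.+1)) -[h - b]/(t`_(@lift m.+2 ord0 ord0)).
  by rewrite !coord_free //; case: j => -[|[|j]] ? /=; rewrite ?addr0 ?add0r.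
have [u uE {1}->] := decomp x; have [v vE {1}->] := decomp y.
rewrite namulDl (ann_mulr _ uE) addr0 namulDr (ann_mull _ vE) addr0.
rewrite namulDl !namulDr !namulZl !namulZr (namulC (h - b)) pp qq pq.
by rewrite !scaler0 addr0 add0r !scalerA scalerN scalerBl.
Qed.

(** A vector whose image has its first two coordinates zero annihilates [E]; these two functionals
    supply the two hyperplanes. *)
Lemma codim_ann_of_isomorphic (E : naAlgType K) (a b : E) n : hyperbolic_pair a b ->
  \dim {:E} = n.+2 -> isomorphic E (E2 K n.+2) -> (\dim (ann E) + 2 = \dim {:E})%N.
Proof.
move=> abP dimE [f [g fK _] fM].
have lin_f i : linear (fun x => (f x : 'rV_n.+2) 0 i : K^o).
  move=> c x y; have -> : (f (c *: x + y) : 'rV_n.+2) = c *: (f x : 'rV_n.+2) + f y.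
    exact: linearP.
  by rewrite !mxE.
pose F i : {linear E -> K^o} := HB.pack (fun x : E => (f x : 'rV_n.+2) 0 i : K^o)
  (GRing.isLinear.Build _ _ _ _ _ (lin_f i)).
apply: (codim_ann_eq2 abP (dim_lker_functional (linfun (F 0)))
  (dim_lker_functional (linfun (F 1)))).
apply/subvP => x /memv_capP[]; rewrite !memv_ker !lfunE /= => /eqP x0 /eqP x1.
apply/annP => y; apply: (can_inj fK); rewrite fM linear0.
suff : (namul (f x) (f y) : 'rV_n.+2) = 0 by [].
by rewrite E2_namulE x0 x1 !mul0r subrr scale0r.
Qed.

End Models.

Theorem theorem4p1 (K : fieldType) (charK : 2%N \notin [pchar K])
    (E : naAlgType K) (n : nat) (e : n.-tuple E)
    (basis_e : natural_basis e) (TE : in_T E) :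
  [<-> (\dim (ann E) + 2)%N = \dim {:E};
       isomorphic E (E2 K n);
       exists U : {vspace E},
         [/\ subalgebra U, (asoc E + U)%VS = fullv & (asoc E :&: U)%VS = 0%VS];
       frattini E = 0%VS /\ frattini_ideal E = 0%VS;
       abelian_ideal (nilrad E)] /\
  ((\dim (ann E) + 2)%N <> \dim {:E} ->
   [/\ frattini E = frattini_ideal E,
       frattini_ideal E = naprod (nilrad E) (nilrad E) &
       naprod (nilrad E) (nilrad E) = naprod {:E} {:E}]).
Proof.
have two0 : 2%:R != 0 :> K by move: charK; rewrite inE.
have [a [b abP]] := in_T_hyperbolic_pair two0 TE; have [a0 derE _ _ _] := abP.
have nE : n = \dim {:E} by have [/size_basis] := basis_e.
have frE := frattini_eq_a abP.
split; last by move=> dimE; have [-> ->] := frE dimE;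
  rewrite (nilrad_square abP dimE) derE.
tfae.
- move=> dimE; rewrite nE -dimE addn2.
  exact: isomorphic_E2 two0 _ _ _ abP dimE.
(* The independent vectors [a] and [b] force dimension at least two, so [n] has the shape [m.+2] of
   the model. *)
- have : (1 < n)%N.
    rewrite nE; apply: leq_trans (dimvS (subvf (ann E + <[a]> + <[b]>))).
    by rewrite (dim_ann_plane abP) addn2.
  case: n nE {e basis_e} => [|[|m]] // nE _ iso.
  apply/(codim_ann_splits abP).
  exact: codim_ann_of_isomorphic abP (esym nE) iso.
- move=> /(codim_ann_splits abP) dimE.
  have F0 := frattini_eq0 abP dimE; split=> //.
  by have [_ + _] := frattini_idealP E; rewrite F0 subv0 => /eqP.
(* Outside codimension two the Frattini subalgebra would be the nonzero line of [a]. *)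
- move=> [F0 _]; split; first by have [[]] := nilradP E.
  apply/(nilrad_abelianP abP); apply: contrapT => /frE[Fa _].
  by move: (memv_line a); rewrite -Fa F0 memv0 (negPf a0).
- by case=> _ /(nilrad_abelianP abP).
Qed.
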